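(* For a given (mixed) $n$-qubit state $\rho$ with bipartition $A|B$, there exists an efficient algorithm to measure $r_4(\rho)$ to additive precision $\epsilon$ with failure probability $\delta$ using $O(\epsilon^{-2}\log(2/\delta))$ copies of $\rho$, $O(1)$ circuit depth, $O(1)$ layers of CNOT and Hadamard gates, and $O(n\,\epsilon^{-2}\log(2/\delta))$ classical post-processing time.
   Context: The realignment matrix $R_\rho$ of $\rho$ is defined in the computational basis by $\langle a,a'|R_\rho|b,b'\rangle=\langle a,b|\rho|a',b'\rangle$, with $a,a'$ basis labels of $A$ and $b,b'$ basis labels of $B$. The fourth realignment moment is $r_4(\rho)=\mathrm{tr}\big((R_\rho^\dagger R_\rho)^2\big)$. The circuits act jointly on several copies of $\rho$. *)

(* Defs.v *)
From mathcomp Require Import all_boot all_order all_algebra.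
From mathcomp Require Import sesquilinear spectral.
From mathcomp Require Import reals exp.
From mathcomp.real_closed Require Import complex.

Set Implicit Arguments.
Unset Strict Implicit.
Unset Printing Implicit Defensive.

Import Order.TTheory GRing.Theory Num.Theory.
Local Open Scope ring_scope.
Local Open Scope complex_scope.
Local Open Scope sesquilinear_scope.

(* Computational basis labels of a register whose qubits are named by Q. *)
Definition basis (Q : finType) : finType := {ffun Q -> bool}.

(* Matrices whose rows and columns are indexed by finite types: MathComp only
   has matrices indexed by ordinals, so indices go through the canonical
   enumerations of I and J. *)
Definition fmx (R : Type) (I J : finType) (F : I -> J -> R) :
    'M[R]_(#|I|, #|J|) :=
  \matrix_(i, j) F (enum_val i) (enum_val j).

Definition entry (R : Type) (I J : finType) (M : 'M[R]_(#|I|, #|J|))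
  (x : I) (y : J) : R := M (enum_rank x) (enum_rank y).

Notation operator R Q := 'M[R[i]]_(#|basis Q|).

Definition density_operator (R : realType) (Q : finType) (rho : operator R Q) :=
  [/\ rho ^t* = rho,
      forall v : 'cV[R[i]]_(#|basis Q|), 0 <= (v ^t* *m rho *m v) 0 0 &
      \tr rho = 1].

(* A bipartition A|B of the qubits 'I_n is given by A, with B the complement.
   [merge a b] is the basis label of the whole system restricting to a on A
   and to b on B. *)
Definition merge n (A : {set 'I_n}) (a : basis {q | q \in A})
    (b : basis {q | q \notin A}) : basis 'I_n :=
  [ffun q => match boolP (q \in A) with
             | AltTrue qA => a (exist _ q qA)
             | AltFalse qB => b (exist _ q qB)
             end].

(* Rows are indexed by pairs of labels of A, columns by pairs of labels of B;
   the matrix is rectangular in general. *)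
Definition realignment (R : realType) n (A : {set 'I_n})
    (rho : operator R 'I_n) :=
  fmx (fun (a : basis {q | q \in A} * basis {q | q \in A})
           (b : basis {q | q \notin A} * basis {q | q \notin A}) =>
         entry rho (merge a.1 b.1) (merge a.2 b.2)).

Definition r4 (R : realType) n (A : {set 'I_n}) (rho : operator R 'I_n) : R[i] :=
  let M := realignment A rho in \tr ((M ^t* *m M) ^+ 2).

(* Qubit q of copy j is named (q, j). *)
Definition tensor_power (R : realType) n c (rho : operator R 'I_n) :
    operator R ('I_n * 'I_c)%type :=
  fmx (fun x y : basis ('I_n * 'I_c)%type =>
         \prod_(j < c) entry rho [ffun q => x (q, j)] [ffun q => y (q, j)]).

Inductive layer (Q : Type) :=
  | HLayer of seq Q
  | CNOTLayer of seq (Q * Q).  (* (control, target) pairs *)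

Definition circuit Q := seq (layer Q).

(* The gates of a layer act on pairwise distinct qubits (in particular no CNOT
   has its control as target), so that a layer has depth one. *)
Definition layer_wf (Q : eqType) (l : layer Q) : bool :=
  match l with
  | HLayer s => uniq s
  | CNOTLayer s => uniq (unzip1 s ++ unzip2 s)
  end.

Definition depth Q (c : circuit Q) : nat := size c.

Section Semantics.
Variables (R : realType) (Q : finType).

Definition hadamard (q : Q) : operator R Q :=
  fmx (fun x y : basis Q =>
         if [forall p, (p != q) ==> (x p == y p)]
         then (-1) ^+ (x q && y q) * ((Num.sqrt 2)^-1)%:C else 0).

Definition cnot_label (g : Q * Q) (y : basis Q) : basis Q :=
  [ffun p => if p == g.2 then y g.1 (+) y g.2 else y p].

Definition cnot (g : Q * Q) : operator R Q :=
  fmx (fun x y : basis Q => (x == cnot_label g y)%:R).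

Definition layer_op (l : layer Q) : operator R Q :=
  match l with
  | HLayer s => foldr (fun q U => hadamard q *m U) 1%:M s
  | CNOTLayer s => foldr (fun g U => cnot g *m U) 1%:M s
  end.

(* The first layer of the list is applied first. *)
Definition circuit_op (c : circuit Q) : operator R Q :=
  foldl (fun U l => layer_op l *m U) 1%:M c.

(* Born rule for the measurement of all qubits in the computational basis after
   running the circuit c on the state sigma. *)
Definition born (c : circuit Q) (sigma : operator R Q) (x : basis Q) : R :=
  complex.Re (entry (circuit_op c *m sigma *m (circuit_op c) ^t*) x x).

(* K runs of the circuit, each on a fresh register in state sigma: probability
   that the list of outcomes satisfies E. *)
Definition prob_runs (c : circuit Q) (sigma : operator R Q) (K : nat)
    (E : pred {ffun 'I_K -> basis Q}) : R :=
  \sum_(w | E w) \prod_(k < K) born c sigma (w k).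

End Semantics.

(* The input is a read-only memory of natural numbers, the output a list of
   integers; there are finitely many integer registers, named by nat. Constants
   aside, the arithmetic is limited to successor and predecessor, so that after
   t steps all numbers are bounded by the input and t up to an additive
   constant, and charging one unit of time per instruction is legitimate. *)
Inductive instr :=
  | Const of nat & int
  | Copy of nat & nat
  | Incr of nat
  | Decr of nat
  | Fetch of nat & nat  (* Fetch r a: r receives the input at address a *)
  | Emit of nat.

Inductive cmd :=
  | Do of instr
  | Then of cmd & cmd
  | IfPos of nat & cmd & cmd
  | WhilePos of nat & cmd.

Record state := State { regs : nat -> int; output : seq int }.

Definition init_state := State (fun=> 0) [::].

Definition set_reg (s : state) (r : nat) (v : int) : state :=
  State (fun k => if k == r then v else regs s k) (output s).

Definition run_instr (mem : seq nat) (i : instr) (s : state) : state :=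
  match i with
  | Const r v => set_reg s r v
  | Copy r a => set_reg s r (regs s a)
  | Incr r => set_reg s r (regs s r + 1)
  | Decr r => set_reg s r (regs s r - 1)
  | Fetch r a =>
      set_reg s r (if regs s a is Posz k then (nth 0%N mem k)%:Z else 0)
  | Emit r => State (regs s) (rcons (output s) (regs s r))
  end.

(* [exec mem c s t s']: started in state s, c halts in state s' after exactly t
   units of time; every instruction and every test takes one unit. *)
Inductive exec (mem : seq nat) : cmd -> state -> nat -> state -> Prop :=
  | ExecDo i s : exec mem (Do i) s 1 (run_instr mem i s)
  | ExecThen c1 c2 s s1 s2 t1 t2 :
      exec mem c1 s t1 s1 -> exec mem c2 s1 t2 s2 ->
      exec mem (Then c1 c2) s (t1 + t2) s2
  | ExecIfT r c1 c2 s s' t :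
      0 < regs s r -> exec mem c1 s t s' -> exec mem (IfPos r c1 c2) s t.+1 s'
  | ExecIfF r c1 c2 s s' t :
      regs s r <= 0 -> exec mem c2 s t s' -> exec mem (IfPos r c1 c2) s t.+1 s'
  | ExecWhileT r c s s1 s2 t1 t2 :
      0 < regs s r -> exec mem c s t1 s1 -> exec mem (WhilePos r c) s1 t2 s2 ->
      exec mem (WhilePos r c) s (t1 + t2).+1 s2
  | ExecWhileF r c s :
      regs s r <= 0 -> exec mem (WhilePos r c) s 1 s.

(* Qubit (q, j) of a register of n x c qubits is wire number q * c + j. *)
Definition wire n c (p : 'I_n * 'I_c) : nat := (p.1 * c + p.2)%N.

Definition encode_layer n c (l : layer ('I_n * 'I_c)) : seq int :=
  match l with
  | HLayer s => (- 1%:Z) :: [seq (wire p)%:Z | p <- s]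
  | CNOTLayer s =>
      (- 2%:Z) :: flatten [seq [:: (wire g.1)%:Z; (wire g.2)%:Z] | g <- s]
  end.

Definition encode_circuit n c (C : circuit ('I_n * 'I_c)) : seq int :=
  flatten (map (@encode_layer n c) C).

Definition encode_bipartition n (A : {set 'I_n}) : seq nat :=
  n :: [seq nat_of_bool (q \in A) | q <- enum 'I_n].

(* All measured bits, run by run and, within a run, by wire number. *)
Definition encode_outcomes n c K
    (w : {ffun 'I_K -> basis ('I_n * 'I_c)%type}) : seq nat :=
  flatten [seq [seq nat_of_bool (w k (q, j)) | q <- enum 'I_n, j <- enum 'I_c]
          | k <- enum 'I_K].

(* An algorithm runs one circuit, acting jointly on [copies] copies of the
   state, [shots eps delta] times on fresh copies, measures all qubits in the
   computational basis and processes the outcomes classically. The two classical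
   programs are fixed once and for all: the same text serves every number of
   qubits, bipartition, precision and failure probability. *)
Record algorithm (R : realType) := Algorithm {
  copies : nat;
  circuits : forall n, {set 'I_n} -> circuit ('I_n * 'I_copies);
  generator : cmd;
  shots : R -> R -> nat;
  postprocess : cmd
}.

Definition copies_used (R : realType) (P : algorithm R) (eps delta : R) : nat :=
  (copies P * shots P eps delta)%N.

(* [generates P A t]: the generator writes down the circuit for the bipartition
   A in time t. *)
Definition generates (R : realType) (P : algorithm R) n (A : {set 'I_n})
    (t : nat) : Prop :=
  exists2 s, exec (encode_bipartition A) (generator P) init_state t s &
             output s = encode_circuit (circuits P A).

Definition outcomes (R : realType) (P : algorithm R) n (eps delta : R) : finType :=
  {ffun 'I_(shots P eps delta) -> basis ('I_n * 'I_(copies P))%type}.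

(* [returns A w t v]: on the outcomes w the post-processing halts in time t and
   returns the rational number v as a numerator and a denominator. *)
Definition returns (R : realType) (P : algorithm R) n (A : {set 'I_n})
    (eps delta : R) (w : outcomes P n eps delta) (t : nat) (v : R) : Prop :=
  exists s (num den : int),
    [/\ exec (shots P eps delta :: encode_bipartition A ++ encode_outcomes w)
             (postprocess P) init_state t s,
        output s = [:: num; den], den != 0 & v = num%:~R / den%:~R].

Definition failure_probability (R : realType) (P : algorithm R) n
    (A : {set 'I_n}) (eps delta : R) (est : outcomes P n eps delta -> R)
    (rho : operator R 'I_n) : R :=
  prob_runs (circuits P A) (tensor_power (copies P) rho)
    (fun w : outcomes P n eps delta => ~~ (`|(est w)%:C - r4 A rho| <= eps%:C)).

(* Main.v *)
Require Import Defs.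
From mathcomp Require Import all_boot all_order all_algebra.
From mathcomp Require Import sesquilinear spectral.
From mathcomp Require Import boolp reals sequences exp zify ring lra.
From mathcomp.real_closed Require Import complex.

Set Implicit Arguments.
Unset Strict Implicit.
Unset Printing Implicit Defensive.

Import Order.TTheory GRing.Theory Num.Theory.
Local Open Scope ring_scope.

(* Expanding the trace, r4 = sum of rho(a'b',ab) rho(ad,a'd') rho(c'd',cd)
   rho(cb,c'b'), i.e. the expectation on four copies of rho of the operator that
   exchanges copies 0,1 and 2,3 of the qubits of A and copies 0,3 and 1,2 of the
   qubits of B. It is a product of disjoint SWAPs. One layer of CNOTs followed by
   one layer of Hadamards on the controls measures every pair in the Bell basis,
   where SWAP is -1 on the singlet (outcome 11) and 1 otherwise; so r4 is the
   expectation of a sign that is the parity of the number of singlets, and a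
   Chernoff bound controls the empirical mean. *)

(** Circuits and states are handled through matrix entries. For gates on distinct qubits these are
    products of one-qubit factors, so a sum over outcomes becomes a product of two-term sums. One
    such sum, with a switch for the parity sign, yields both the normalisation and the mean of the
    outcome distribution. Non-negativity needs its own argument: positivity of a quadratic form does
    not pass visibly to tensor powers, whereas a Gram factorisation does. The classical costs
    concern concrete register programs, whose straight-line pieces are run symbolically and whose
    loops carry invariants indexed by the items still to be treated. *)

(** Since exp(-x) >= 1 - x, exp x is at most 1/(1-x), and (1-x)(1+x+2x^2) = 1 + x^2(1-2x). *)
Lemma expR_quad_bound (R : realType) (x : R) : x <= 2^-1 -> expR x <= 1 + x + 2 * x ^+ 2.
Proof.
move=> hx; have h1 : 0 < 1 - x by lra.
have h2 := expR_ge1Dx (- x).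
have h3 : 1 <= (1 - x) * (1 + x + 2 * x ^+ 2).
  have : 0 <= x ^+ 2 * (1 - 2 * x) by rewrite mulr_ge0 ?sqr_ge0 //; lra.
  by rewrite expr2; nra.
have h4 : (1 - x) * expR x <= 1.
  have := ler_wpM2r (expR_ge0 x) h2.
  by rewrite -expRD addNr expR0.
by rewrite -(ler_pM2l h1); apply: le_trans h4 h3.
Qed.

(** * Concentration of the empirical mean *)

Section Chernoff.
Variables (R : realType) (T : finType) (mu : T -> R).
Hypothesis mu_ge0 : forall x, 0 <= mu x.
Hypothesis mu_sum1 : \sum_x mu x = 1.

Lemma sum_prob_prod K (f : T -> R) :
  \sum_(w : {ffun 'I_K -> T}) \prod_k (mu (w k) * f (w k)) =
  (\sum_x mu x * f x) ^+ K.
Proof.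
rewrite -(bigA_distr_bigA (fun (_ : 'I_K) x => mu x * f x)).
by rewrite prodr_const card_ord.
Qed.

(* Markov on exp(s * sum) with s = eps/4: the exponent is K(2s^2 - s eps). *)
Lemma chernoff_upper K (f : T -> R) (eps : R) :
  0 <= eps <= 1 -> (forall x, `|f x| <= 1) ->
  \sum_(w : {ffun 'I_K -> T} |
          K%:R * (\sum_x mu x * f x + eps) <= \sum_k f (w k)) \prod_k mu (w k)
  <= expR (- (K%:R * eps ^+ 2 / 8)).
Proof.
set m := \sum_x mu x * f x => /andP[eps0 eps1] f1.
have m1 : `|m| <= 1.
  apply: le_trans (ler_norm_sum _ _ _) _; rewrite -mu_sum1.
  by apply: ler_sum => x _; rewrite normrM (ger0_norm (mu_ge0 x)) ler_piMr.
(* The minimiser of 2s^2 - s eps; as |f x - m| <= 2 and eps <= 1, it also keeps s(f x - m) <= 1/2,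
   as [expR_quad_bound] requires. *)
pose s := eps / 4.
pose g x := expR (s * (f x - m)).
have g_sum : \sum_x mu x * g x <= expR (2 * s ^+ 2).
  apply: (@le_trans _ _ (1 + 2 * s ^+ 2)); last exact: expR_ge1Dx.
  (* The quadratic bound with (f x)^2 replaced by 1. What remains is affine in f x, so its mean is 1
     + 2s^2 - 2s^2 m^2. *)
  have Eg x : mu x * g x <= mu x * (1 - s * m - 2 * s ^+ 2 * m ^+ 2 + 2 * s ^+ 2 * (1 + 2 * m^+2))
     + mu x * f x * (s - 4 * s ^+ 2 * m).
    have /andP[l u] : -1 <= f x <= 1 by rewrite -ler_norml.
    have /andP[l' u'] : -1 <= m <= 1 by rewrite -ler_norml.
    have h : s * (f x - m) <= 2^-1 by rewrite /s; nra.
    have := ler_wpM2l (mu_ge0 x) (expR_quad_bound h).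
    have : 0 <= mu x * (2 * s ^+ 2 * (1 - f x ^+ 2)).
      have q : 0 <= 1 - f x ^+ 2 by rewrite expr2; nra.
      apply: mulr_ge0 => //; apply: mulr_ge0 => //.
      by apply: mulr_ge0 => //; apply: sqr_ge0.
    rewrite /g; set e := expR _.
    rewrite -subr_ge0 => A; rewrite -subr_ge0 => B; rewrite -subr_ge0.
    apply: le_trans (addr_ge0 A B) _; rewrite le_eqVlt; apply/orP; left.
    by apply/eqP; ring.
  apply: le_trans (ler_sum _ (fun x _ => Eg x)) _.
  rewrite big_split /= -!mulr_suml mu_sum1 -/m mul1r.
  have : 0 <= s ^+ 2 * m ^+ 2 by rewrite mulr_ge0 ?sqr_ge0.
  by rewrite !expr2; nra.
pose Kr : R := K%:R.
have step (w : {ffun 'I_K -> T}) : Kr * (m + eps) <= \sum_k f (w k) ->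
  \prod_k mu (w k) <= expR (- (s * (Kr * eps))) * \prod_k (mu (w k) * g (w k)).
  move=> hw; rewrite big_split /= mulrCA ler_peMr ?prodr_ge0 //.
  rewrite /g -expR_sum -expRD -{1}expR0 ler_expR -mulr_sumr sumrB.
  rewrite sumr_const card_ord -mulr_natl -/Kr addrC -mulrBr.
  by apply: mulr_ge0; rewrite /s ?divr_ge0 //; nra.
apply: le_trans (ler_sum _ step) _.
apply: (@le_trans _ _ (\sum_(w : {ffun 'I_K -> T}) expR (- (s * (Kr * eps))) *
           \prod_k (mu (w k) * g (w k)))).
  rewrite [leRHS](bigID (fun w : {ffun 'I_K -> T} => Kr * (m + eps) <= \sum_k f (w k))) /=.
  rewrite ler_wpDr ?sumr_ge0 // => w _; rewrite mulr_ge0 ?expR_ge0 ?prodr_ge0 //.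
  by move=> k _; rewrite mulr_ge0 ?expR_ge0.
rewrite -mulr_sumr sum_prob_prod.
apply: (@le_trans _ _ (expR (- (s * (Kr * eps))) * expR (2 * s ^+ 2) ^+ K)).
  rewrite ler_pM2l ?expR_gt0 // lerXn2r ?nnegrE ?expR_ge0 //.
  by apply: sumr_ge0 => x _; rewrite mulr_ge0 ?expR_ge0.
rewrite -expRM_natl -expRD ler_expR /s -/Kr.
by rewrite le_eqVlt; apply/orP; left; apply/eqP; field.
Qed.

(** The one-sided bound for f and for -f; this union bound is the source of the 2 in ln (2 /
    delta). *)
Lemma chernoff K (f : T -> R) (eps : R) :
  (0 < K)%N -> 0 <= eps <= 1 -> (forall x, `|f x| <= 1) ->
  \sum_(w : {ffun 'I_K -> T} |
          ~~ (`|(\sum_k f (w k)) / K%:R - \sum_x mu x * f x| <= eps))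
     \prod_k mu (w k)
  <= 2 * expR (- (K%:R * eps ^+ 2 / 8)).
Proof.
move=> K0 heps f1.
have K0' : 0 < K%:R :> R by rewrite ltr0n.
have up := chernoff_upper K heps f1.
have f1' x : `|- f x| <= 1 by rewrite normrN.
have lo := chernoff_upper K heps f1'.
have -> : 2 = 1 + 1 :> R by [].
rewrite mulrDl mul1r; apply: le_trans (lerD up lo).
set m := \sum_x mu x * f x.
have -> : \sum_x mu x * - f x = - m.
  by rewrite /m -sumrN; apply: eq_bigr => x _; rewrite mulrN.
rewrite [X in X <= _]big_mkcond [X in _ <= X + _]big_mkcond
  [X in _ <= _ + X]big_mkcond -big_split /=.
apply: ler_sum => w _; rewrite -ltNge sumrN.
have p0 : 0 <= \prod_k mu (w k) by apply: prodr_ge0.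
case: ifPn => [|_]; last by rewrite addr_ge0 //; case: ifP.
rewrite ltr_normr => /orP[] h.
- rewrite ifT ?lerDl; first by case: ifP.
  have : m + eps <= (\sum_k f (w k)) / K%:R by lra.
  by rewrite ler_pdivlMr // mulrC.
- rewrite [X in _ + X]ifT ?lerDr; first by case: ifP.
  have : - m + eps <= - (\sum_k f (w k)) / K%:R by rewrite mulNr; lra.
  by rewrite ler_pdivlMr // mulrC.
Qed.
End Chernoff.

(** * The swap test *)

Section Entries.
Local Open Scope sesquilinear_scope.

Lemma entry_fmx (T : Type) (I J : finType) (F : I -> J -> T) x y :
  entry (fmx F) x y = F x y.
Proof. by rewrite /entry mxE !enum_rankK. Qed.

Lemma entry_mul (T : pzRingType) (I J L : finType) (M : 'M[T]_(#|I|, #|J|))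
    (N : 'M[T]_(#|J|, #|L|)) x y :
  entry (M *m N) x y = \sum_(z : J) entry M x z * entry N z y.
Proof. by rewrite /entry mxE (reindex _ (onW_bij _ (@enum_rank_bij J))). Qed.

Lemma entry_1 (T : pzRingType) (I : finType) (x y : I) :
  entry (1%:M : 'M[T]_#|I|) x y = (x == y)%:R.
Proof. by rewrite /entry mxE (inj_eq enum_rank_inj). Qed.

Lemma entry_adjoint (C : numClosedFieldType) (I J : finType)
    (M : 'M[C]_(#|I|, #|J|)) x y :
  entry (M ^t*) x y = (entry M y x)^*.
Proof. by rewrite /entry !mxE. Qed.

Lemma trace_entry (T : pzRingType) (I : finType) (M : 'M[T]_#|I|) :
  \tr M = \sum_(x : I) entry M x x.
Proof. by rewrite /mxtrace (reindex _ (onW_bij _ (@enum_rank_bij I))). Qed.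

End Entries.

Lemma prod_indicator (T : comPzRingType) (I : finType) (b : I -> bool) :
  \prod_i (b i)%:R = [forall i, b i]%:R :> T.
Proof.
case: forallP => [h|/forallP]; first by apply: big1 => i _; rewrite h.
by rewrite negb_forall => /existsP[i hi]; rewrite (bigD1 i) //= (negbTE hi) mul0r.
Qed.

Section ComplexReal.
Variable R : realType.

Lemma ReM_real (r : R) (z : complex R) :
  complex.Re (real_complex R r * z) = r * complex.Re z.
Proof. by case: z => a b /=; rewrite mul0r subr0. Qed.

Lemma conj_real_complex (r : R) : (real_complex R r)^* = real_complex R r.
Proof. by apply/CrealP; rewrite complex_real eqxx. Qed.

End ComplexReal.

Section Layers.
Variables (R : realType) (Q : finType).
Implicit Types (x y z : basis Q) (s : seq Q).

Let h : R := (Num.sqrt 2)^-1.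

(** Real-valued and a product over qubits, so that sums over labels factor by [bigA_distr_bigA]. *)
Definition hadamards_entry s x y : R :=
  \prod_p (if p \in s then (-1) ^+ (x p && y p) * h else (x p == y p)%:R).

Lemma entry_hadamard q x y :
  entry (hadamard R q) x y = real_complex R (hadamards_entry [:: q] x y).
Proof.
rewrite entry_fmx /hadamards_entry (bigD1 q) //= inE eqxx.
case: forallP => [H|/forallP].
  rewrite big1 ?mulr1 ?rmorphM ?rmorphXn ?rmorphN1 //.
  by move=> p pq; rewrite inE (negbTE pq); have /implyP/(_ pq) -> := H p.
rewrite negb_forall => /existsP[p]; rewrite negb_imply => /andP[pq /negbTE e].
by rewrite (bigD1 p) //= inE (negbTE pq) e mul0r mulr0 rmorph0.
Qed.

(** No qubit carries two gates, so on each qubit one of the two factors is an identity and the sum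
    over the intermediate bit collapses. *)
Lemma entry_HLayer s x y : uniq s ->
  entry (layer_op R (HLayer s)) x y = real_complex R (hadamards_entry s x y).
Proof.
elim: s x y => [|q s IH] x y /=.
  move=> _; rewrite entry_1 /hadamards_entry /= prod_indicator rmorph_nat.
  congr (_ : bool)%:R; apply/eqP/forallP => [->//|H].
  by apply/ffunP => p; apply/eqP.
move=> /andP[qs us]; rewrite entry_mul.
under eq_bigr => z _ do rewrite entry_hadamard (IH z y us) -rmorphM /= -big_split /=.
rewrite -rmorph_sum /=; congr (real_complex R _).
rewrite -(bigA_distr_bigA (fun p (b : bool) =>
  (if p \in [:: q] then (-1) ^+ (x p && b) * h else (x p == b)%:R) *
  (if p \in s then (-1) ^+ (b && y p) * h else (b == y p)%:R))).
apply: eq_bigr => p _; rewrite big_bool !inE; case: eqVneq => [->|pq] /=.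
  by rewrite (negbTE qs); case: (x q); case: (y q); rewrite /= ?mulr0 ?mulr1 ?addr0 ?add0r.
by case: (p \in s); case: (x p); case: (y p); rewrite /= ?mul0r ?mul1r ?addr0 ?add0r.
Qed.

Definition cnot_labels (gs : seq (Q * Q)) y : basis Q := foldr (@cnot_label Q) y gs.

Lemma entry_CNOTLayer gs x y :
  entry (layer_op R (CNOTLayer gs)) x y = (x == cnot_labels gs y)%:R.
Proof.
elim: gs x y => [|g gs IH] x y /=; first by rewrite entry_1.
rewrite entry_mul (bigD1 (cnot_labels gs y)) //= IH eqxx mulr1 big1 ?addr0.
  by rewrite entry_fmx.
by move=> z /negbTE hz; rewrite IH hz mulr0.
Qed.

End Layers.

(* Destructive swap test: each control c is paired with the target
   [partner c]; conjugating the parity observable by the circuit gives the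
   operator exchanging paired qubits. *)
Section SwapTest.
Variables (R : realType) (Q : finType) (ctrls : seq Q) (partner : Q -> Q).
Hypothesis partnerK : involutive partner.
Hypothesis partner_ctrls : forall q, (partner q \in ctrls) = (q \notin ctrls).
Hypothesis ctrls_uniq : uniq ctrls.
Implicit Types (x y z : basis Q).

Definition swap_circuit : circuit Q :=
  [:: CNOTLayer [seq (c, partner c) | c <- ctrls]; HLayer ctrls].

Lemma swap_circuit_wf : all (@layer_wf _) swap_circuit.
Proof.
rewrite /= ctrls_uniq !andbT /unzip1 /unzip2 -!map_comp /= map_id cat_uniq.
rewrite ctrls_uniq (map_inj_uniq (inv_inj partnerK)) ctrls_uniq andbT /=.
apply/hasPn => q /mapP[c hc ->]; rewrite /=.
by rewrite partner_ctrls hc.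
Qed.

Definition swap_label y : basis Q := [ffun p => y (partner p)].

Definition singlet_parity x : bool :=
  \big[addb/false]_(c <- ctrls) (x c && x (partner c)).

Let cn y : basis Q := [ffun p => if p \in ctrls then y p else y (partner p) (+) y p].

Lemma cnot_labels_partner y :
  cnot_labels [seq (c, partner c) | c <- ctrls] y = cn y.
Proof.
(* Generalised to a sublist of the controls: no target is a control, so every gate reads the
   original value of its control. *)
have E s : uniq s -> {subset s <= ctrls} -> forall p,
    cnot_labels [seq (c, partner c) | c <- s] y p =
    if partner p \in s then y (partner p) (+) y p else y p.
  elim: s => [|c s IH] //= /andP[cs us] sub p.
  have subs : {subset s <= ctrls} by move=> q qs; apply: sub; rewrite inE qs orbT.
  have cctrl : c \in ctrls by apply: sub; rewrite inE eqxx.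
  have pcs : (partner c \in s) = false.
    by apply/negP => /subs; rewrite partner_ctrls cctrl.
  rewrite ffunE /= !(IH us subs) inE; case: eqVneq => [->|ne].
    by rewrite partnerK eqxx /= pcs (negbTE cs).
  by rewrite (_ : partner p == c = false) //; apply: contraNF ne => /eqP <-; rewrite partnerK.
apply/ffunP => p; rewrite E // ffunE partner_ctrls.
by case: (p \in ctrls).
Qed.

Lemma entry_swap_circuit x y :
  entry (circuit_op R swap_circuit) x y =
  real_complex R (hadamards_entry R ctrls x (cn y)).
Proof.
rewrite /circuit_op [foldl _ _ _]/= mulmx1 entry_mul (bigD1 (cn y)) //=.
rewrite (entry_CNOTLayer R [seq (c, partner c) | c <- ctrls]) cnot_labels_partner.
rewrite eqxx mulr1 (entry_HLayer _ _ _ ctrls_uniq) big1 ?addr0 // => z /negbTE hz.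
rewrite (entry_CNOTLayer R [seq (c, partner c) | c <- ctrls]) cnot_labels_partner.
by rewrite hz mulr0.
Qed.

(* [e = false] expresses that the circuit is unitary, [e = true] evaluates the
   parity observable. *)
Lemma hadamards_conj (e : bool) y z :
  \sum_(x : basis Q) (-1) ^+ (e && singlet_parity x) * hadamards_entry R ctrls x (cn y) *
     hadamards_entry R ctrls x (cn z) =
  (z == (if e then swap_label y else y))%:R.
Proof.
set u := cn y; set v := cn z; pose h : R := (Num.sqrt 2)^-1.
have hh : h * h = 2^-1.
  by rewrite -expr2 exprVn sqr_sqrtr.
(* The sign at a control p involves x at its target. No Hadamard acts there, so this bit may be
   replaced by that of u, and the summand splits into one factor per qubit. *)
pose G p (b : bool) : R := if p \in ctrls then
  (-1) ^+ (e && b && u (partner p)) * ((-1) ^+ (b && u p) * h) * ((-1) ^+ (b && v p) * h)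
  else (b == u p)%:R * (b == v p)%:R.
transitivity (\sum_(x : basis Q) \prod_p G p (x p)).
  apply: eq_bigr => x _.
  have -> : (-1) ^+ (e && singlet_parity x) =
      \prod_p (if p \in ctrls then (-1) ^+ (e && x p && x (partner p)) else 1) :> R.
    rewrite -big_mkcond -big_uniq //= /singlet_parity.
    elim: (ctrls) => [|c s IH]; first by rewrite !big_nil andbF.
    by rewrite !big_cons -IH -signr_addb -andbA andb_addr.
  rewrite /hadamards_entry -!big_split /=.
  have [/forallP xu|] := boolP [forall p, (p \notin ctrls) ==> (x p == u p)].
    apply: eq_bigr => p _; rewrite /G; case: ifP => pc; last by rewrite mul1r.
    have /implyP := xu (partner p); rewrite partner_ctrls pc => /(_ isT) /eqP <-.
    by [].
  rewrite negb_forall => /existsP[p]; rewrite negb_imply => /andP[/negbTE pc /negbTE pu].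
  by rewrite (bigD1 p) //= [RHS](bigD1 p) //= /G pc pu mulr0 !mul0r.
rewrite -(bigA_distr_bigA G).
(* At a control, the sum over b of (-1)^(b t) / 2 is the indicator of t = 0. *)
transitivity (\prod_p ((if p \in ctrls then u p (+) v p (+) (e && u (partner p)) == false
                         else u p == v p)%:R : R)).
  apply: eq_bigr => p _; rewrite big_bool /G {G}; case: ifP => pc.
    have two : 2^-1 + 2^-1 = 1 :> R by field.
    by case: e; case: (u p); case: (v p); case: (u (partner p));
      rewrite /= !(expr0, expr1, mulN1r, mul1r, mulNr, mulrN, opprK, hh, two, addNr, subrr).
  by case: (u p); case: (v p); rewrite /= ?mulr1 ?mulr0 ?addr0 ?add0r.
(* With e, the condition at a control reads y p + z p + (y p + y (partner p)) = 0, i.e. z p = y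
   (partner p); equality of the XORs at the targets then fixes the other half of z. *)
rewrite {G} prod_indicator {}/u {}/v; congr (_ : bool)%:R; apply/forallP/eqP => [H|->].
  have Hc p : p \in ctrls -> z p = if e then y (partner p) else y p.
    move=> pc; have := H p; rewrite pc !ffunE pc partner_ctrls pc /= partnerK.
    by clear H; case: e; case: (y p); case: (z p); case: (y (partner p)).
  apply/ffunP => p; case pc : (p \in ctrls).
    by rewrite Hc //; clear H Hc; case: e; rewrite ?ffunE.
  have ppc : partner p \in ctrls by rewrite partner_ctrls pc.
  have := H p; rewrite pc !ffunE pc (Hc _ ppc) partnerK.
  by clear H Hc; case: e; rewrite ?ffunE; case: (y p); case: (z p); case: (y (partner p)).
move=> p; rewrite !ffunE partner_ctrls; case: ifP => pc /=; last first.
  by case: e; rewrite ?ffunE ?partner_ctrls ?pc ?partnerK //; case: (y p); case: (y (partner p)).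
by case: e; rewrite ?ffunE ?partner_ctrls ?pc ?partnerK /=; case: (y p); case: (y (partner p)).
Qed.

(** Heisenberg picture: with the outcome sum innermost, [hadamards_conj] evaluates it. The
    right-hand side is the trace of sigma, or of sigma times the exchange operator. *)
Lemma born_parity_sum (e : bool) (sigma : operator R Q) :
  \sum_(x : basis Q) (-1) ^+ (e && singlet_parity x) * born swap_circuit sigma x =
  complex.Re (\sum_y entry sigma y (if e then swap_label y else y)).
Proof.
pose H := hadamards_entry R ctrls.
transitivity (complex.Re (\sum_(x : basis Q) \sum_z \sum_y entry sigma y z *
   real_complex R ((-1) ^+ (e && singlet_parity x) * H x (cn y) * H x (cn z)))).
  rewrite raddf_sum /=; apply: eq_bigr => x _.
  rewrite /born -ReM_real; congr complex.Re.
  rewrite entry_mul mulr_sumr; apply: eq_bigr => z _.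
  rewrite entry_adjoint entry_mul mulr_suml mulr_sumr; apply: eq_bigr => y _.
  rewrite !entry_swap_circuit -/H !rmorphM /= -/(Num.conj _) conj_real_complex.
  by ring.
congr complex.Re; rewrite exchange_big /=.
under eq_bigr => z _ do rewrite exchange_big /=.
rewrite exchange_big /=; apply: eq_bigr => y _.
under eq_bigr => z _ do rewrite -mulr_sumr -rmorph_sum /= hadamards_conj rmorph_nat.
rewrite (bigD1 (if e then swap_label y else y)) //= eqxx mulr1 big1 ?addr0 // => z.
by move=> /negbTE ->; rewrite mulr0.
Qed.
End SwapTest.

(** * States and realignment *)

Section States.
Local Open Scope sesquilinear_scope.
Variable R : realType.

(** sigma = B^* B with rows of B indexed by any finite type: a form of positivity that passes
    directly to tensor powers. *)
Definition gram_form (Q : finType) (sigma : operator R Q) :=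
  exists (K : finType) (B : K -> basis Q -> complex R),
    forall x y, entry sigma x y = \sum_k (B k x)^* * B k y.

Lemma born_ge0 (Q : finType) (c : circuit Q) (sigma : operator R Q) x :
  gram_form sigma -> 0 <= born c sigma x.
Proof.
move=> [K [B EB]]; rewrite /born; set U := circuit_op R c.
suff : 0 <= entry (U *m sigma *m U ^t*) x x by rewrite lecE => /andP[].
have -> : entry (U *m sigma *m U ^t*) x x =
    \sum_k (\sum_z B k z * (entry U x z)^*)^* * (\sum_z B k z * (entry U x z)^*).
  transitivity (\sum_z \sum_k (\sum_y entry U x y * (B k y)^*) * (B k z * (entry U x z)^*)).
    rewrite entry_mul; apply: eq_bigr => z _.
    rewrite entry_adjoint entry_mul mulr_suml.
    under eq_bigr => y _ do rewrite EB mulr_sumr mulr_suml.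
    rewrite exchange_big /=; apply: eq_bigr => k _; rewrite mulr_suml.
    by apply: eq_bigr => y _; rewrite !mulrA.
  rewrite exchange_big /=; apply: eq_bigr => k _; rewrite -mulr_sumr; congr (_ * _).
  by rewrite rmorph_sum; apply: eq_bigr => z _; rewrite rmorphM /= conjCK mulrC.
by apply: sumr_ge0 => k _; rewrite mulrC mul_conjC_ge0.
Qed.

(** By the spectral theorem rho = P^* D P, and B = sqrt(D) P; the eigenvalues are values of the
    positive form at the eigenvectors. *)
Lemma density_gram (Q : finType) (rho : operator R Q) :
  density_operator rho -> gram_form rho.
Proof.
move=> [herm pos _]; pose P := spectralmx rho; pose d := spectral_diag rho.
have unP : P \is unitarymx by apply: spectral_unitarymx.
have E : rho = P ^t* *m diag_mx d *m P.
  rewrite -invmx_unitary //; apply/orthomx_spectralP.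
  by apply/normalmxP; rewrite herm.
have d0 k : 0 <= d 0 k.
  have := pos ((row k P) ^t*); rewrite trmxCK.
  have PPt : P *m P ^t* = 1%:M by apply/unitarymxP.
  suff -> : (row k P *m rho *m (row k P) ^t*) 0 0 = d 0 k by [].
  have -> : d 0 k = (P *m rho *m P ^t*) k k.
    by rewrite E !mulmxA PPt mul1mx -mulmxA PPt mulmx1 mxE eqxx.
  by rewrite -row_mul !mxE; apply: eq_bigr => i _; rewrite !mxE.
exists 'I_#|basis Q|, (fun k x => sqrtC (d 0 k) * P k (enum_rank x)) => x y.
rewrite /entry {1}E mxE; apply: eq_bigr => k _.
rewrite mul_mx_diag !mxE rmorphM /=.
have -> : (sqrtC (d 0 k))^* = sqrtC (d 0 k) by apply/CrealP/ger0_real; rewrite sqrtC_ge0.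
by rewrite -{1}[d 0 k]sqrtCK; ring.
Qed.

Section TensorPower.
Variables (n c : nat).

Definition copy (x : basis ('I_n * 'I_c)%type) (j : 'I_c) : basis 'I_n :=
  [ffun q => x (q, j)].

Definition join_copies (g : {ffun 'I_c -> basis 'I_n}) : basis ('I_n * 'I_c)%type :=
  [ffun p => g p.2 p.1].

Lemma copy_join g j : copy (join_copies g) j = g j.
Proof. by apply/ffunP => q; rewrite !ffunE. Qed.

Lemma join_copies_bij : bijective join_copies.
Proof.
exists (fun x => [ffun j => copy x j]) => [g|x].
  by apply/ffunP => j; rewrite ffunE copy_join.
by apply/ffunP => -[q j]; rewrite !ffunE.
Qed.

Lemma entry_tensor_power (rho : operator R 'I_n) x y :
  entry (tensor_power c rho) x y = \prod_j entry rho (copy x j) (copy y j).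
Proof. by rewrite entry_fmx. Qed.

Lemma tensor_power_gram (rho : operator R 'I_n) :
  gram_form rho -> gram_form (tensor_power c rho).
Proof.
move=> [K [B EB]].
exists {ffun 'I_c -> K}, (fun (f : {ffun 'I_c -> K}) x => \prod_j B (f j) (copy x j)) => x y.
rewrite entry_tensor_power (eq_bigr _ (fun j _ => EB _ _)) bigA_distr_bigA /=.
by apply: eq_bigr => f _; rewrite rmorph_prod -big_split.
Qed.

Lemma trace_tensor_power (rho : operator R 'I_n) :
  \sum_x entry (tensor_power c rho) x x = (\tr rho) ^+ c.
Proof.
rewrite (reindex _ (onW_bij _ join_copies_bij)) /=.
under eq_bigr => g _ do rewrite entry_tensor_power.
under eq_bigr => g _ do under eq_bigr => j _ do rewrite copy_join.
rewrite -(bigA_distr_bigA (fun (_ : 'I_c) x => entry rho x x)) /=.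
by rewrite prodr_const card_ord trace_entry.
Qed.

End TensorPower.
End States.

(** * The realignment moment as an exchange of four copies *)

Local Notation copy0 := (@Ordinal 4 0 isT).
Local Notation copy1 := (@Ordinal 4 1 isT).
Local Notation copy2 := (@Ordinal 4 2 isT).
Local Notation copy3 := (@Ordinal 4 3 isT).

(** Abstracting the [alt_spec] proof resolves the dependent match in [merge]. *)
Lemma alt_spec_true (T : Type) (b c : bool) (s : alt_spec b b c)
    (f : b -> T) (g : ~~ b -> T) (hb : b) :
  match s with AltTrue h => f h | AltFalse h => g h end = f hb.
Proof. by case: s => h; [rewrite (bool_irrelevance h hb) | case/negP: h]. Qed.

Lemma alt_spec_false (T : Type) (b c : bool) (s : alt_spec b b c)
    (f : b -> T) (g : ~~ b -> T) (hb : ~~ b) :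
  match s with AltTrue h => f h | AltFalse h => g h end = g hb.
Proof. by case: s => h; [case/negP: hb | rewrite (bool_irrelevance h hb)]. Qed.

Section Realignment.
Local Open Scope sesquilinear_scope.
Variables (R : realType) (n : nat) (A : {set 'I_n}).

Definition restr_in (x : basis 'I_n) : basis {q | q \in A} := [ffun q => x (val q)].
Definition restr_out (x : basis 'I_n) : basis {q | q \notin A} := [ffun q => x (val q)].

Lemma merge_in a b (q : {q | q \in A}) : Defs.merge a b (val q) = a q.
Proof. by rewrite ffunE; case: q => q qA; apply: alt_spec_true. Qed.

Lemma merge_out a b (q : {q | q \notin A}) : Defs.merge a b (val q) = b q.
Proof. by rewrite ffunE; case: q => q qA; apply: alt_spec_false. Qed.

Lemma restr_in_merge (a : basis {q | q \in A}) b : restr_in (Defs.merge a b) = a.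
Proof. by apply/ffunP => q; rewrite ffunE merge_in. Qed.

Lemma restr_out_merge (a : basis {q | q \in A}) b : restr_out (Defs.merge a b) = b.
Proof. by apply/ffunP => q; rewrite ffunE merge_out. Qed.

Lemma merge_restr x y :
  Defs.merge (restr_in x) (restr_out y) = [ffun q => if q \in A then x q else y q].
Proof.
apply/ffunP => q; rewrite [RHS]ffunE; case: ifPn => qA.
  by rewrite -[q in LHS](SubK {q | q \in A} qA) merge_in ffunE.
by rewrite -[q in LHS](SubK {q | q \notin A} qA) merge_out ffunE.
Qed.

Lemma ord4_ind (P : 'I_4 -> Prop) :
  P copy0 -> P copy1 -> P copy2 -> P copy3 -> forall j, P j.
Proof.
by move=> p0 p1 p2 p3 [[|[|[|[|//]]]] h]; rewrite (bool_irrelevance h isT).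
Qed.

Definition copy_pairing (inA : bool) (j : 'I_4) : 'I_4 :=
  nth copy0 (if inA then [:: copy1; copy0; copy3; copy2] else [:: copy3; copy2; copy1; copy0]) j.

Definition qubit_partner (p : 'I_n * 'I_4) : 'I_n * 'I_4 :=
  (p.1, copy_pairing (p.1 \in A) p.2).

(** Both pairings match an even copy with an odd one, so the even copies serve as controls on either
    side of the bipartition. *)
Definition ctrl_qubits : seq ('I_n * 'I_4) :=
  [seq (q, j) | q <- enum 'I_n, j <- [:: copy0; copy2]].

Lemma mem_ctrl_qubits p : (p \in ctrl_qubits) = ~~ odd p.2.
Proof.
case: p => q j; apply/allpairsP/idP => [[[q' j'] /= [_ hj [_ ->]]]|].
  by move: j' hj; apply: ord4_ind.
by move=> hj; exists (q, j); rewrite mem_enum; split=> //; move: j hj; apply: ord4_ind.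
Qed.

Lemma qubit_partnerK : involutive qubit_partner.
Proof.
move=> [q j]; rewrite /qubit_partner /=; congr (_, _).
by case: (q \in A); move: j; apply: ord4_ind.
Qed.

Lemma qubit_partner_ctrl p : (qubit_partner p \in ctrl_qubits) = (p \notin ctrl_qubits).
Proof.
rewrite !mem_ctrl_qubits; case: p => q j; rewrite /=.
by case: (q \in A); move: j; apply: ord4_ind.
Qed.

Lemma ctrl_qubits_uniq : uniq ctrl_qubits.
Proof. by rewrite allpairs_uniq ?enum_uniq // => -[? ?] [? ?]. Qed.

Let labels_in := basis {q | q \in A}.
Let labels_out := basis {q | q \notin A}.

(** The row labels of copies 0 to 3 are a'b', ad, c'd', cb: each of the eight indices of the trace
    occurs in exactly one of them. The nesting is that of the sum after [pair_big]. *)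
Let split_copies (y : basis ('I_n * 'I_4)%type) :
    ((labels_out * labels_out) * (labels_out * labels_out)) *
    ((labels_in * labels_in) * (labels_in * labels_in)) :=
  (((restr_out (copy y copy3), restr_out (copy y copy0)),
    (restr_out (copy y copy1), restr_out (copy y copy2))),
   ((restr_in (copy y copy1), restr_in (copy y copy0)),
    (restr_in (copy y copy3), restr_in (copy y copy2)))).

Let split_copies_bij : bijective split_copies.
Proof.
exists (fun t => join_copies [ffun j : 'I_4 => nth [ffun=> false]
   [:: Defs.merge t.2.1.2 t.1.1.2; Defs.merge t.2.1.1 t.1.2.1;
       Defs.merge t.2.2.2 t.1.2.2; Defs.merge t.2.2.1 t.1.1.1] j]).
  move=> y; apply/ffunP => -[q j]; rewrite !ffunE /=.
  by move: j; apply: ord4_ind; rewrite /= merge_restr !ffunE; case: ifP.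
move=> [[[b b'] [d d']] [[a a'] [c c']]].
by rewrite /split_copies !copy_join !ffunE /= !restr_in_merge !restr_out_merge.
Qed.

Lemma r4_swap (rho : operator R 'I_n) : rho ^t* = rho ->
  \sum_y entry (tensor_power 4 rho) y (swap_label qubit_partner y) = r4 A rho.
Proof.
move=> herm.
(* Hermiticity turns the conjugates coming from the adjoint of the realignment matrix into
   transposed entries of rho. *)
have conj_rho x y : (entry rho x y)^* = entry rho y x by rewrite -entry_adjoint herm.
rewrite /r4 expr2 trace_entry.
under [RHS]eq_bigr => b _.
  rewrite entry_mul.
  under eq_bigr => d _.
    rewrite !entry_mul mulr_sumr.
    under eq_bigr => g _.
      rewrite mulr_suml.
      under eq_bigr => a _ do rewrite !entry_adjoint !entry_fmx !conj_rho.
      over.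
    over.
  over.
rewrite pair_big /=.
under [RHS]eq_bigr => b _ do rewrite exchange_big pair_big /=.
rewrite pair_big /= (reindex _ (onW_bij _ split_copies_bij)) /=.
apply: eq_bigr => y _; rewrite entry_tensor_power.
rewrite !merge_restr !big_ord_recl big_ord0 mulr1 !mulrA.
have same j : [ffun q => if q \in A then copy y j q else copy y j q] = copy y j.
  by apply/ffunP => q; rewrite [LHS]ffunE if_same.
have swap j : copy (swap_label qubit_partner y) j =
    [ffun q => if q \in A then copy y (copy_pairing true j) q
               else copy y (copy_pairing false j) q].
  by apply/ffunP => q; rewrite !ffunE /qubit_partner /=; case: (q \in A).
have -> : lift ord0 (lift ord0 (lift ord0 ord0)) = copy3 by apply: val_inj.
have -> : lift ord0 (lift ord0 ord0) = copy2 by apply: val_inj.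
have -> : lift ord0 ord0 = copy1 by apply: val_inj.
have -> : ord0 = copy0 by apply: val_inj.
by rewrite !same !swap.
Qed.

End Realignment.

(** * Register programs *)

Section Machine.
Variable mem : seq nat.

(* Unlike the register file [nat -> int], a list of register contents
   computes. *)
Definition list_state (vs out : seq int) : state := State (nth 0 vs) out.

Lemma list_state_nil : list_state [::] [::] = init_state.
Proof. by congr State; apply/funext => k; rewrite nth_nil. Qed.

Lemma set_reg_list vs out r v :
  set_reg (list_state vs out) r v = list_state (set_nth 0 vs r v) out.
Proof. by congr State; apply/funext => k; rewrite nth_set_nth. Qed.

(** Unlike v + 1, this reduces on [Posz k] with k a variable, so symbolic runs simplify. *)
Definition incz (v : int) : int := if v is Posz k then Posz k.+1 else v + 1.
Definition decz (v : int) : int := if v is Posz k.+1 then Posz k else v - 1.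

Lemma inczE v : incz v = v + 1.
Proof. by case: v => // k; rewrite /incz intS addrC. Qed.

Lemma deczE v : decz v = v - 1.
Proof. by case: v => // -[|k] //; rewrite /decz intS addrAC subrr add0r. Qed.

Definition eval_instr i (vs out : seq int) : seq int * seq int :=
  match i with
  | Const r v => (set_nth 0 vs r v, out)
  | Copy r a => (set_nth 0 vs r (nth 0 vs a), out)
  | Incr r => (set_nth 0 vs r (incz (nth 0 vs r)), out)
  | Decr r => (set_nth 0 vs r (decz (nth 0 vs r)), out)
  | Fetch r a =>
      (set_nth 0 vs r (if nth 0 vs a is Posz k then (nth 0%N mem k)%:Z else 0), out)
  | Emit r => (vs, rcons out (nth 0 vs r))
  end.

(** The value at [WhilePos] is a dummy: [halts_loop_free] asks for [loop_free], and loops go through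
    [halts_while]. *)
Fixpoint eval c (vs out : seq int) : seq int * seq int :=
  match c with
  | Do i => eval_instr i vs out
  | Then c1 c2 => let st := eval c1 vs out in eval c2 st.1 st.2
  | IfPos r c1 c2 => if 0 < nth 0 vs r then eval c1 vs out else eval c2 vs out
  | WhilePos _ _ => (vs, out)
  end.

Fixpoint loop_free c : bool :=
  match c with
  | Do _ => true
  | Then c1 c2 | IfPos _ c1 c2 => loop_free c1 && loop_free c2
  | WhilePos _ _ => false
  end.

Fixpoint time_bound c : nat :=
  match c with
  | Do _ => 1
  | Then c1 c2 => time_bound c1 + time_bound c2
  | IfPos _ c1 c2 => (maxn (time_bound c1) (time_bound c2)).+1
  | WhilePos _ _ => 0
  end.

(** Total-correctness judgement with time budget T and postcondition P. *)
Definition halts_with c T (P : seq int -> seq int -> Prop) (vs out : seq int) :=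
  exists t vs' out',
    [/\ exec mem c (list_state vs out) t (list_state vs' out'), (t <= T)%N & P vs' out'].

Lemma halts_loop_free c (P : seq int -> seq int -> Prop) vs out :
  loop_free c -> P (eval c vs out).1 (eval c vs out).2 ->
  halts_with c (time_bound c) P vs out.
Proof.
move=> lf Pe; suff [t [ex le]] : exists t,
    exec mem c (list_state vs out) t (list_state (eval c vs out).1 (eval c vs out).2)
    /\ (t <= time_bound c)%N by exists t, (eval c vs out).1, (eval c vs out).2.
elim: c vs out lf {Pe} => [i|c1 IH1 c2 IH2|r c1 IH1 c2 IH2|//] vs out /=.
- move=> _; exists 1; split=> //.
  have -> : list_state (eval_instr i vs out).1 (eval_instr i vs out).2 =
            run_instr mem i (list_state vs out).
    by case: i => * /=; rewrite ?set_reg_list //= ?inczE ?deczE.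
  exact: ExecDo.
- move=> /andP[l1 l2]; have [t1 [e1 le1]] := IH1 vs out l1.
  have [t2 [e2 le2]] := IH2 (eval c1 vs out).1 (eval c1 vs out).2 l2.
  by exists (t1 + t2)%N; split; [apply: ExecThen e1 e2 | apply: leq_add].
- move=> /andP[l1 l2]; case: ltP => hr.
    have [t [e le]] := IH1 vs out l1.
    by exists t.+1; split; [apply: ExecIfT | rewrite ltnS leq_max le].
  have [t [e le]] := IH2 vs out l2.
  by exists t.+1; split; [apply: ExecIfF | rewrite ltnS leq_max le orbT].
Qed.

Lemma halts_then c1 c2 T1 T2 (P Q : seq int -> seq int -> Prop) vs out :
  halts_with c1 T1 Q vs out -> (forall vs' out', Q vs' out' -> halts_with c2 T2 P vs' out') ->
  halts_with (Then c1 c2) (T1 + T2) P vs out.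
Proof.
move=> [t1 [vs1 [out1 [e1 le1 q]]]] /(_ _ _ q) [t2 [vs2 [out2 [e2 le2 p]]]].
exists (t1 + t2)%N, vs2, out2; split=> //; [exact: ExecThen e1 e2|exact: leq_add].
Qed.

(** The list l of items left serves as termination measure. Each round pays one test, and the final
    failing test gives the extra 1. *)
Lemma halts_while (X : Type) r c T (I : seq X -> seq int -> seq int -> Prop) l vs out :
  (forall x l vs out, I (x :: l) vs out ->
     0 < nth 0 vs r /\ halts_with c T (I l) vs out) ->
  (forall vs out, I [::] vs out -> nth 0 vs r <= 0) ->
  I l vs out -> halts_with (WhilePos r c) (T.+1 * size l + 1) (I [::]) vs out.
Proof.
move=> step stop; elim: l vs out => [|x l IH] vs out Il.
  by exists 1%N, vs, out; split; [apply/ExecWhileF/(stop _ _ Il) | rewrite muln0 |].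
have [r0 [t1 [vs1 [out1 [e1 le1 i1]]]]] := step _ _ _ _ Il.
have [t2 [vs2 [out2 [e2 le2 i2]]]] := IH _ _ i1.
exists (t1 + t2).+1, vs2, out2; split=> //; first exact: ExecWhileT e1 e2.
by rewrite /= mulnS; lia.
Qed.

Lemma nth_drop_cons k v (l : seq nat) : drop k mem = v :: l -> nth 0%N mem k = v.
Proof. by move=> e; rewrite -[k]addn0 -nth_drop e. Qed.

Lemma drop_succ k v (l : seq nat) : drop k mem = v :: l -> drop k.+1 mem = l.
Proof. by move=> e; rewrite -add1n -drop_drop e /= drop0. Qed.

End Machine.

(** * The circuit generator *)

Definition block (c : cmd) (cs : seq cmd) : cmd :=
  foldl Then c cs.

(* Registers: 1 number of qubits, 2 address in the bipartition, 3 first wire of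
   the current qubit, 4 qubits left, 5 side of the qubit, 6 to 8 its other wires. *)
Definition gen_cnots : cmd :=
  block (Do (Fetch 5 2)) [:: Do (Incr 2); Do (Emit 3);
    Do (Copy 6 3); Do (Incr 6); Do (Copy 7 6); Do (Incr 7); Do (Copy 8 7); Do (Incr 8);
    IfPos 5 (block (Do (Emit 6)) [:: Do (Emit 7); Do (Emit 8)])
            (block (Do (Emit 8)) [:: Do (Emit 7); Do (Emit 6)]);
    Do (Copy 3 8); Do (Incr 3); Do (Decr 4)].

Definition gen_hadamards : cmd :=
  block (Do (Emit 3)) [:: Do (Incr 3); Do (Incr 3); Do (Emit 3); Do (Incr 3);
    Do (Incr 3); Do (Decr 4)].

(** [Const 8 0] pads the register list to length 9, the shape used in the loop invariants. *)
Definition gen_start : cmd :=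
  block (Do (Fetch 1 0)) [:: Do (Const 2 1); Do (Const 3 0); Do (Copy 4 1);
    Do (Const 8 0); Do (Const 5 (- 2%:Z)); Do (Emit 5)].

Definition gen_middle : cmd :=
  block (Do (Const 5 (- 1%:Z))) [:: Do (Emit 5); Do (Const 3 0); Do (Copy 4 1)].

Definition gen_program : cmd :=
  block gen_start [:: WhilePos 4 gen_cnots; gen_middle; WhilePos 4 gen_hadamards].

Section Generator.
Variables (n : nat) (A : {set 'I_n}).

Let cnot_code (q : 'I_n) : seq int :=
  let w := (q * 4)%N in
  if q \in A then [:: w%:Z; w.+1%:Z; w.+2%:Z; w.+3%:Z]
  else [:: w%:Z; w.+3%:Z; w.+2%:Z; w.+1%:Z].

Let hadamard_code (q : 'I_n) : seq int := [:: (q * 4)%:Z; (q * 4).+2%:Z].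

Lemma encode_swap_circuit :
  encode_circuit (swap_circuit (ctrl_qubits n) (qubit_partner A)) =
  (- 2%:Z) :: flatten (map cnot_code (enum 'I_n)) ++
  (- 1%:Z) :: flatten (map hadamard_code (enum 'I_n)).
Proof.
rewrite /encode_circuit /= cats0 /ctrl_qubits; congr (_ :: _ ++ _ :: _).
  elim: (enum 'I_n) => [//|q l IH] /=; rewrite IH /cnot_code /wire /qubit_partner /=.
  by case: (q \in A); rewrite /= addn0 addn1 addn2 addn3.
elim: (enum 'I_n) => [//|q l IH] /=; rewrite IH /wire /=.
by rewrite addn0 addn2.
Qed.

(** Per qubit, the two loop bodies cost at most 16 and 7 units plus a test each, hence 25; set-up
    costs 7 + 4 and the two exit tests 2. *)
Lemma generator_spec :
  exists2 t, (t <= 25 * n + 13)%N &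
    exists2 s, exec (encode_bipartition A) gen_program init_state t s &
      output s = encode_circuit (swap_circuit (ctrl_qubits n) (qubit_partner A)).
Proof.
set mem := encode_bipartition A.
pose bit (q : 'I_n) : nat := q \in A.
pose code1 := (- 2%:Z) :: flatten (map cnot_code (enum 'I_n)).
pose code := code1 ++ (- 1%:Z) :: flatten (map hadamard_code (enum 'I_n)).
(* The output is described by what it still lacks, so the empty list gives the complete code. *)
pose I1 (l : seq 'I_n) (vs out : seq int) := exists a i v5 v6 v7 v8,
  [/\ vs = [:: 0; n%:Z; Posz a; Posz (i * 4); (size l)%:Z; v5; v6; v7; v8],
      map val l = iota i (size l), drop a mem = map bit l &
      out ++ flatten (map cnot_code l) = code1].
pose I2 (l : seq 'I_n) (vs out : seq int) := exists v1 v2 i v5 v6 v7 v8,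
  [/\ vs = [:: 0; v1; v2; Posz (i * 4); (size l)%:Z; v5; v6; v7; v8],
      map val l = iota i (size l) &
      out ++ flatten (map hadamard_code l) = code].
suff : halts_with mem gen_program (25 * n + 13) (I2 [::]) [::] [::].
  move=> [t [vs [out [e le [? [? [? [? [? [? [? [_ _ +]]]]]]]]]]]].
  rewrite cats0 => Eout; exists t; first exact: le.
  exists (list_state vs out).
    by rewrite -list_state_nil.
  by rewrite encode_swap_circuit.
have sizeE : size (enum 'I_n) = n by rewrite -cardE card_ord.
have valE : map val (enum 'I_n) = iota 0 (size (enum 'I_n)) by rewrite sizeE val_enum_ord.
have -> : (25 * n + 13 =
    time_bound gen_start + (17 * n + 1) + time_bound gen_middle + (8 * n + 1))%N.
  by rewrite /=; lia.
rewrite /gen_program /block /=.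
apply: (@halts_then _ _ _ _ _ _ (I2 (enum 'I_n))); last first.
  move=> vs out; rewrite (_ : 8 * n = 8 * size (enum 'I_n))%N; last by rewrite sizeE.
  apply: (@halts_while _ _ _ _ 7 I2) =>
    {vs out} [q l vs out|vs out [? [? [? [? [? [? [? [-> _ _]]]]]]]]] //.
  move=> [v1 [v2 [i [v5 [v6 [v7 [v8 [-> /= [Ei Eval] Eout]]]]]]]]; split=> //.
  apply: halts_loop_free => //=.
  exists v1, v2, i.+1, v5, v6, v7, v8; split=> //.
  by rewrite -Eout /hadamard_code Ei -!cats1 -!catA.
apply: (@halts_then _ _ _ _ _ _ (I1 [::])); last first.
  move=> vs out [a [i [v5 [v6 [v7 [v8 [-> _ _]]]]]]]; rewrite cats0 => ->.
  apply: halts_loop_free => //=.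
  exists n%:Z, a%:Z, 0%N, (- 1%:Z), v6, v7, v8; split=> //; first by rewrite sizeE.
  by rewrite cat_cons cat_rcons.
apply: (@halts_then _ _ _ _ _ _ (I1 (enum 'I_n))); last first.
  move=> vs out; rewrite (_ : 17 * n = 17 * size (enum 'I_n))%N; last by rewrite sizeE.
  apply: (@halts_while _ _ _ _ 16 I1) =>
    {vs out} [q l vs out|vs out [? [? [? [? [? [? [-> _ _ _]]]]]]]] //.
  move=> [a [i [v5 [v6 [v7 [v8 [-> /= [Ei Eval] Ea Eout]]]]]]]; split=> //.
  apply: halts_loop_free => //=; rewrite (nth_drop_cons Ea) ltz_nat lt0b.
  exists a.+1, i.+1, (bit q)%:Z, (i * 4).+1%:Z, (i * 4).+2%:Z, (i * 4).+3%:Z.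
  rewrite /bit; split; rewrite ?(drop_succ Ea) //; first by case: (q \in A).
  by rewrite -Eout /cnot_code Ei; case: (q \in A); rewrite /= -!cats1 -!catA.
apply: halts_loop_free => //=.
exists 1%N, 0%N, (- 2%:Z), 0, 0, 0; split=> //; first by rewrite sizeE.
by rewrite /mem /encode_bipartition /= drop0.
Qed.
End Generator.

(** * The post-processing program *)

(** Register 0 holds 0 throughout. *)
Definition nop : cmd := Do (Const 0 0).

Definition flip_sign : cmd := IfPos 6 (Do (Const 6 0)) (Do (Const 6 1)).

(* Registers: 1 runs left, 2 number of qubits, 3 address in the bipartition,
   4 address in the outcomes, 5 qubits left, 6 parity of the run, 7 sum of the
   signs, 8 to 12 outcomes of the four copies of a qubit and its side. *)
Definition qubit_fetch : cmd :=
  block (Do (Fetch 12 3)) [:: Do (Incr 3); Do (Fetch 8 4); Do (Incr 4);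
    Do (Fetch 9 4); Do (Incr 4); Do (Fetch 10 4); Do (Incr 4);
    Do (Fetch 11 4); Do (Incr 4)].

(* Outside A, outcomes 1 and 3 are exchanged, so that the pairs are always 8,9
   and 10,11. *)
Definition qubit_update : cmd :=
  block (IfPos 12 nop (block (Do (Copy 13 9)) [:: Do (Copy 9 11); Do (Copy 11 13)]))
    [:: IfPos 8 (IfPos 9 flip_sign nop) nop;
        IfPos 10 (IfPos 11 flip_sign nop) nop; Do (Decr 5)].

(** The side bits start at address 2 and are reread in every run, whereas the outcome address in
    register 4 moves on. *)
Definition run_start : cmd :=
  block (Do (Const 3 2)) [:: Do (Copy 5 2); Do (Const 6 0)].

Definition run_end : cmd :=
  block (IfPos 6 (Do (Decr 7)) (Do (Incr 7))) [:: Do (Decr 1)].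

Definition run_step : cmd :=
  block run_start [:: WhilePos 5 (Then qubit_fetch qubit_update); run_end].

(** The outcomes start at address n + 2, after the number of shots, n and the n side bits.
    [Const 13 0] pads the register list to length 14. *)
Definition post_start : cmd :=
  block (Do (Fetch 1 0)) [:: Do (Const 2 1); Do (Fetch 2 2); Do (Copy 4 2);
    Do (Incr 4); Do (Incr 4); Do (Const 7 0); Do (Const 13 0)].

Definition post_end : cmd :=
  block (Do (Emit 7)) [:: Do (Fetch 1 0); Do (Emit 1)].

Definition post_program : cmd :=
  block post_start [:: WhilePos 1 run_step; post_end].

Lemma enum_ord4 : enum 'I_4 = [:: copy0; copy1; copy2; copy3].
Proof. by apply: (inj_map val_inj); rewrite val_enum_ord. Qed.

Section Postprocessing.
Variables (n K : nat) (A : {set 'I_n}).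
Variable w : {ffun 'I_K -> basis ('I_n * 'I_4)%type}.

Let side (q : 'I_n) : nat := q \in A.

Let bits (x : basis ('I_n * 'I_4)%type) (q : 'I_n) : seq nat :=
  [:: nat_of_bool (x (q, copy0)); nat_of_bool (x (q, copy1));
      nat_of_bool (x (q, copy2)); nat_of_bool (x (q, copy3))].

Let qubit_parity (x : basis ('I_n * 'I_4)%type) (q : 'I_n) : bool :=
  (x (q, copy0) && x (qubit_partner A (q, copy0))) (+)
  (x (q, copy2) && x (qubit_partner A (q, copy2))).

Let parity := singlet_parity (ctrl_qubits n) (qubit_partner A).

Lemma parityE x : parity x = \big[addb/false]_(q <- enum 'I_n) qubit_parity x q.
Proof.
rewrite /parity /singlet_parity /ctrl_qubits.
elim: (enum 'I_n) => [|q l IH]; first by rewrite !big_nil.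
by rewrite /= 3!big_cons IH addbA.
Qed.

Lemma encode_outcomesE :
  encode_outcomes w = flatten [seq flatten (map (bits (w k)) (enum 'I_n)) | k <- enum 'I_K].
Proof. by rewrite /encode_outcomes enum_ord4. Qed.

Let mem : seq nat := K :: encode_bipartition A ++ encode_outcomes w.

(** [tot] is the parity of the whole run, [l] its qubits left, [rest] the outcomes of later runs. *)
Let run_inv x v1 v7 tot rest (l : seq 'I_n) (vs out : seq int) :=
  exists a i (p : bool) v8 v9 v10 v11 v12 v13,
  [/\ vs = [:: 0; v1; n%:Z; Posz a; Posz i; (size l)%:Z; p%:Z; v7; v8; v9; v10; v11; v12; v13],
      drop a mem = map side l ++ encode_outcomes w,
      drop i mem = flatten (map (bits x) l) ++ rest,
      p (+) \big[addb/false]_(q <- l) qubit_parity x q = tot &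
      out = [::]].

Let qubit_step_spec x v1 v7 tot rest q l vs out :
  run_inv x v1 v7 tot rest (q :: l) vs out ->
  0 < nth 0 vs 5 /\
  halts_with mem (Then qubit_fetch qubit_update) (10 + 13) (run_inv x v1 v7 tot rest l) vs out.
Proof.
clearbody mem; move=> [a [i [p [v8 [v9 [v10 [v11 [v12 [v13 [-> /= Ea Ei Ep ->]]]]]]]]]]; split=> //.
have Ei1 := drop_succ Ei; have Ei2 := drop_succ Ei1; have Ei3 := drop_succ Ei2.
apply: (@halts_then _ _ _ _ _ _ (fun vs out => vs = [:: 0; v1; n%:Z; a.+1%:Z; i.+4%:Z;
    (size l).+1%:Z; p%:Z; v7; (x (q, copy0) : nat)%:Z; (x (q, copy1) : nat)%:Z;
    (x (q, copy2) : nat)%:Z; (x (q, copy3) : nat)%:Z; (side q)%:Z; v13] /\ out = [::])).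
  apply: halts_loop_free => //=.
  by rewrite (nth_drop_cons Ea) (nth_drop_cons Ei) (nth_drop_cons Ei1)
    (nth_drop_cons Ei2) (nth_drop_cons Ei3).
move=> _ _ [-> ->].
(* The fetched registers now hold explicit bits, so the update is checked on all 64 values of the
   side, the four outcomes and the parity; the registers touched by the exchange stay
   existential. *)
have E : exists u9 u11 u13, eval mem qubit_update
    [:: 0; v1; n%:Z; a.+1%:Z; i.+4%:Z;
    (size l).+1%:Z; p%:Z; v7; (x (q, copy0) : nat)%:Z; (x (q, copy1) : nat)%:Z;
    (x (q, copy2) : nat)%:Z; (x (q, copy3) : nat)%:Z; (side q)%:Z; v13] [::] =
    ([:: 0; v1; n%:Z; a.+1%:Z; i.+4%:Z;
    (size l)%:Z; (p (+) qubit_parity x q : bool)%:Z; v7; (x (q, copy0) : nat)%:Z; u9;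
    (x (q, copy2) : nat)%:Z; u11; (side q)%:Z; u13], [::]).
  rewrite /qubit_parity.
  have -> : qubit_partner A (q, copy0) = (q, if q \in A then copy1 else copy3).
    by rewrite /qubit_partner /=; case: (q \in A).
  have -> : qubit_partner A (q, copy2) = (q, if q \in A then copy3 else copy1).
    by rewrite /qubit_partner /=; case: (q \in A).
  rewrite /side; case: (q \in A); case: (x (q, copy0)); case: (x (q, copy1)); case: (x (q, copy2));
    case: (x (q, copy3)); case: (p); by do 3 eexists.
have [u9 [u11 [u13 Eev]]] := E.
apply: halts_loop_free => //; rewrite Eev.
exists a.+1, i.+4, (p (+) qubit_parity x q); do 6 eexists; split=> //.
- exact: drop_succ Ea.
- exact: drop_succ Ei3.
- by rewrite -Ep big_cons addbA.
Qed.

Let total_inv (l : seq 'I_K) (vs out : seq int) :=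
  exists v3 i v5 v6 v7 v8 v9 v10 v11 v12 v13,
  [/\ vs = [:: 0; (size l)%:Z; n%:Z; v3; Posz i; v5; v6; v7; v8; v9; v10; v11; v12; v13],
      drop i mem = flatten [seq flatten (map (bits (w k)) (enum 'I_n)) | k <- l],
      v7 + \sum_(k <- l) (-1) ^+ parity (w k) = \sum_k (-1) ^+ parity (w k) &
      out = [::]].

Let run_step_spec k l vs out :
  total_inv (k :: l) vs out ->
  0 < nth 0 vs 1 /\ halts_with mem run_step (24 * n + 7) (total_inv l) vs out.
Proof.
move=> [v3 [i [v5 [v6 [v7 [v8 [v9 [v10 [v11 [v12 [v13 [-> /= Ei Es ->]]]]]]]]]]]]; split=> //.
have sizeE : size (enum 'I_n) = n by rewrite -cardE card_ord.
pose rest := flatten [seq flatten (map (bits (w k)) (enum 'I_n)) | k <- l].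
pose J := run_inv (w k) (size l).+1%:Z v7 (parity (w k)) rest.
rewrite /run_step /block [foldl _ _ _]/=.
rewrite (_ : 24 * n + 7 = 3 + (24 * size (enum 'I_n) + 1) + 3)%N; last by rewrite sizeE; lia.
apply: (@halts_then _ _ _ _ _ _ (J [::])); last first.
  move=> vs' out' [a [j [p [u8 [u9 [u10 [u11 [u12 [u13 [-> _ Ej + ->]]]]]]]]]].
  rewrite big_nil addbF => Ep; apply: halts_loop_free => //=; rewrite ltz_nat lt0b.
  exists a%:Z, j, 0, p%:Z, (v7 + (-1) ^+ p), u8, u9, u10, u11, u12, u13.
  split.
  - by case: (p); rewrite /= ?deczE ?inczE.
  - by case: (p).
  - by rewrite -Es big_cons Ep addrA.
  - by case: (p).
apply: (@halts_then _ _ _ _ _ _ (J (enum 'I_n))); last first.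
  move=> vs' out'; apply: (@halts_while _ _ _ _ 23 J) => [q l' us os|us os].
    exact: qubit_step_spec.
  by move=> [? [? [? [? [? [? [? [? [? [-> _ _ _ _]]]]]]]]]].
apply: halts_loop_free => //=.
exists 2, i, false, v8, v9, v10, v11, v12, v13; split=> //; first by rewrite sizeE.
  by rewrite /mem /encode_bipartition /= drop0.
by rewrite addFb -parityE.
Qed.

Lemma postprocess_spec :
  exists2 t, (t <= (24 * n + 8) * K + 12)%N &
    exists2 s, exec mem post_program init_state t s &
      output s = [:: \sum_k (-1) ^+ parity (w k); K%:Z].
Proof.
pose S : int := \sum_k (-1) ^+ parity (w k).
suff [t [vs [out [e le Eout]]]] : halts_with mem post_program ((24 * n + 8) * K + 12)
    (fun _ out => out = [:: S; K%:Z]) [::] [::].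
  by exists t => //; exists (list_state vs out); rewrite -?list_state_nil.
have sizeE : size (enum 'I_K) = K by rewrite -cardE card_ord.
rewrite /post_program /block [foldl _ _ _]/= (_ : (24 * n + 8) * K + 12 =
  8 + ((24 * n + 7).+1 * size (enum 'I_K) + 1) + 3)%N; last by rewrite sizeE; lia.
apply: (@halts_then _ _ _ _ _ _ (total_inv [::])); last first.
  move=> vs out [v3 [i [v5 [v6 [v7 [v8 [v9 [v10 [v11 [v12 [v13 [-> _ + ->]]]]]]]]]]]].
  rewrite big_nil addr0 => Es; apply: halts_loop_free => //=.
  by rewrite Es.
apply: (@halts_then _ _ _ _ _ _ (total_inv (enum 'I_K))); last first.
  move=> vs out; apply: halts_while => [k l us os|us os].
    exact: run_step_spec.
  by move=> [? [? [? [? [? [? [? [? [? [? [? [-> _ _ _]]]]]]]]]]]].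
apply: halts_loop_free => //=.
exists 0, n.+2, 0, 0, 0, 0, 0, 0, 0, 0, 0; split=> //; first by rewrite sizeE.
  rewrite -encode_outcomesE /mem /= drop_size_cat // size_map.
  by rewrite -cardE card_ord.
by rewrite add0r big_enum.
Qed.

End Postprocessing.

(** * The algorithm *)

(** Conjugation swaps row and column of each entry of rho, and reindexing by the involution
    [swap_label] restores the sum. *)
Lemma Re_r4K (R : realType) n (A : {set 'I_n}) (rho : operator R 'I_n) :
  density_operator rho -> real_complex R (complex.Re (r4 A rho)) = r4 A rho.
Proof.
move=> [herm _ _]; apply: RRe_real; apply/CrealP; rewrite -(r4_swap A herm).
rewrite rmorph_sum (reindex (swap_label (qubit_partner A))) /=; last first.
  apply: onW_bij; exists (swap_label (qubit_partner A)) => y;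
  by apply/ffunP => p; rewrite !ffunE qubit_partnerK.
apply: eq_bigr => y _.
have -> : swap_label (qubit_partner A) (swap_label (qubit_partner A) y) = y.
  by apply/ffunP => p; rewrite !ffunE qubit_partnerK.
rewrite !entry_tensor_power rmorph_prod; apply: eq_bigr => j _.
by rewrite /= -entry_adjoint herm.
Qed.

Section Algorithm.
Variable R : realType.
Implicit Types eps delta : R.

(** The 8 cancels that in the exponent of [chernoff]; the successor rounds up and makes the number
    positive. *)
Definition shot_number eps delta : nat :=
  (Num.truncn (8 * (eps ^- 2 * ln (2 / delta)))).+1.

Definition r4_algorithm : algorithm R :=
  @Algorithm R 4 (fun n A => swap_circuit (ctrl_qubits n) (qubit_partner A))
    gen_program shot_number post_program.

(** Lets additive constants be absorbed into the cost: rounding turns 8x into at most 8x + 1 <= 10x.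
    It rests on ln 2 >= 1/2. *)
Lemma cost_ge_half eps delta : 0 < eps <= 1 -> 0 < delta <= 1 ->
  2^-1 <= eps ^- 2 * ln (2 / delta).
Proof.
move=> /andP[e0 e1] /andP[d0 d1].
have ln_half : 2^-1 <= ln (2 / delta).
  rewrite -ler_expR lnK ?posrE ?divr_gt0 //.
  apply: (@le_trans _ _ 2); last by rewrite ler_pdivlMr // ler_piMr.
  have : 2^-1 <= expR (- 2^-1) :> R by apply: le_trans _ (expR_ge1Dx _); lra.
  by rewrite expRN lef_pV2 ?posrE ?expR_gt0.
have : 1 <= eps ^- 2 by rewrite -exprVn exprn_ege1 // invf_ge1.
move=> h; apply: le_trans (ln_half) _; rewrite ler_peMl //.
by apply: le_trans ln_half; rewrite invr_ge0.
Qed.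

Lemma shot_number_bounds eps delta : 0 < eps <= 1 -> 0 < delta <= 1 ->
  8 * (eps ^- 2 * ln (2 / delta)) <= (shot_number eps delta)%:R
    <= 10 * (eps ^- 2 * ln (2 / delta)).
Proof.
move=> he hd; have X := cost_ge_half he hd; set x := _ * _ in X *.
have x0 : 0 <= 8 * x by lra.
have /andP[lo hi] := truncn_itv x0.
rewrite /shot_number -/x (ltW hi) /= -natr1.
by apply: (@le_trans _ _ (8 * x + 1)); [rewrite lerD2r | lra].
Qed.

Lemma failure_bound n (A : {set 'I_n}) eps delta (rho : operator R 'I_n)
    (est : outcomes r4_algorithm n eps delta -> R) :
  0 < eps <= 1 -> 0 < delta <= 1 -> density_operator rho ->
  (forall w, est w = (\sum_k (-1) ^+ singlet_parity (ctrl_qubits n) (qubit_partner A) (w k))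
     / (shot_number eps delta)%:R) ->
  failure_probability A est rho <= delta.
Proof.
move=> he hd rhoD Eest; have [herm _ tr1] := rhoD.
set parity := singlet_parity _ _ in Eest.
set sigma := tensor_power 4 rho.
set circ := swap_circuit (ctrl_qubits n) (qubit_partner A).
have sum_born e := @born_parity_sum R _ (ctrl_qubits n) (qubit_partner A)
  (@qubit_partnerK n A) (@qubit_partner_ctrl n A) (@ctrl_qubits_uniq n) e sigma.
have mu0 x : 0 <= born circ sigma x.
  exact/born_ge0/tensor_power_gram/density_gram.
have mu1 : \sum_x born circ sigma x = 1.
  have := sum_born false; rewrite trace_tensor_power tr1 expr1n /= => <-.
  by apply: eq_bigr => x _; rewrite mul1r.
pose f x : R := (-1) ^+ parity x.
have f1 x : `|f x| <= 1 by rewrite normr_sign.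
have mean : \sum_x born circ sigma x * f x = complex.Re (r4 A rho).
  rewrite -(r4_swap A herm) -(sum_born true).
  by apply: eq_bigr => x _; rewrite mulrC.
have /andP[e0 e1] := he; have /andP[d0 d1] := hd.
have e01 : 0 <= eps <= 1 by rewrite ltW.
apply: (@le_trans _ _ (2 * expR (- ((shot_number eps delta)%:R * eps ^+ 2 / 8)))).
  apply: le_trans (chernoff mu0 mu1 (ltn0Sn _) e01 f1).
  rewrite /failure_probability /prob_runs mean le_eqVlt; apply/orP; left; apply/eqP.
  apply: eq_bigl => w; rewrite Eest -(Re_r4K A rhoD) -rmorphB /=.
  by rewrite normc_def /= expr0n /= addr0 sqrtr_sqr lecR.
have /andP[lo _] := shot_number_bounds he hd.
have lnE : ln (2 / delta) <= (shot_number eps delta)%:R * eps ^+ 2 / 8.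
  have e2 : 0 < eps ^+ 2 by rewrite exprn_gt0.
  rewrite ler_pdivlMr // -ler_pdivrMr //; apply: le_trans lo.
  by rewrite le_eqVlt; apply/orP; left; apply/eqP; ring.
have : expR (- ((shot_number eps delta)%:R * eps ^+ 2 / 8)) <= expR (- ln (2 / delta)).
  by rewrite ler_expR lerN2.
by rewrite [leRHS]expRN lnK ?posrE ?divr_gt0 // invf_div ler_pdivlMr // mulrC.
Qed.

End Algorithm.

Theorem proposition3 (R : realType) :
  exists (P : algorithm R) (C : R) (D : nat),
  forall (n : nat) (A : {set 'I_n}), (0 < n)%N ->
    [/\ exists2 t : nat, (t <= D * n ^ D)%N & generates P A t,
        all (@layer_wf _) (circuits P A)
      & (depth (circuits P A) <= D)%N] /\
    forall eps delta : R, 0 < eps <= 1 -> 0 < delta <= 1 ->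
      (copies_used P eps delta)%:R <= C * (eps ^- 2 * ln (2 / delta)) /\
      exists est : outcomes P n eps delta -> R,
        (forall w : outcomes P n eps delta,
           exists2 t : nat,
             t%:R <= C * (n%:R * eps ^- 2 * ln (2 / delta)) &
             returns A w t (est w)) /\
        (forall rho : operator R 'I_n, density_operator rho ->
           failure_probability A est rho <= delta).
Proof.
(* 38 = 25 + 13 from the generator, also above the depth 2; 440 = 44 * 10, where (24n + 8)K + 12 <=
   44nK for n, K >= 1 and K is at most 10 times the cost. *)
exists (r4_algorithm R), 440, 38 => n A n0; split.
  split=> //; last exact: swap_circuit_wf (@qubit_partnerK n A)
    (@qubit_partner_ctrl n A) (@ctrl_qubits_uniq n).
  have [t le_t gen] := generator_spec A; exists t => //.
  have le_n : (n <= n ^ 38)%N by rewrite -[X in (X <= _)%N]expn1 leq_pexp2l.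
  by lia.
move=> eps delta he hd; have /andP[_ hK] := shot_number_bounds he hd.
have X := cost_ge_half he hd.
split.
  rewrite /copies_used natrM /=; lra.
exists (fun w : outcomes (r4_algorithm R) n eps delta =>
  (\sum_k (-1) ^+ singlet_parity (ctrl_qubits n) (qubit_partner A) (w k))
     / (shot_number eps delta)%:R); split; last first.
  by move=> rho rhoD; apply: failure_bound.
move=> w; have [t le_t [s ex out_s]] := @postprocess_spec n (shot_number eps delta) A w.
exists t.
  have : (t <= 44 * (n * shot_number eps delta))%N.
    apply: leq_trans le_t _; move: (ltn0Sn _ : (0 < shot_number eps delta)%N).
    move: (shot_number eps delta) => K K0; have := leq_pmull K n0.
    by rewrite mulnDl -mulnA; lia.
  rewrite -(ler_nat R) !natrM => h; apply: le_trans h _.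
  rewrite -mulrA (mulrCA 44) (mulrCA 440) ler_wpM2l //.
  by lra.
exists s, (\sum_k (-1) ^+ singlet_parity (ctrl_qubits n) (qubit_partner A) (w k)),
  (shot_number eps delta)%:Z; split=> //.
rewrite rmorph_sum /=; congr (_ / _).
by apply: eq_bigr => k _; rewrite rmorphXn rmorphN1.
Qed.
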